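(* Let $y=y(x)$ satisfy $2\leqslant y\leqslant x$ and $(\log y)/\log\log x\to\infty$ as $x\to\infty$. Then \[ |\mathcal{S}(x,y)+\mathcal{S}(x,y)|=\Psi(x,y)^{1+o(1)}\qquad(x\to\infty), \] i.e., $\log|\mathcal{S}(x,y)+\mathcal{S}(x,y)|/\log\Psi(x,y)\to 1$ as $x\to\infty$.
   Context: For real $x\geqslant y\geqslant 2$, $\mathcal{S}(x,y)=\{n\in\mathbb{Z}_{\geqslant 1} : n\leqslant x,\ P^+(n)\leqslant y\}$, where $P^+(n)$ denotes the largest prime factor of an integer $n\geqslant 2$ and $P^+(1)=1$, and $\Psi(x,y)=|\mathcal{S}(x,y)|$. For a set $\mathcal{A}$ of integers, $\mathcal{A}+\mathcal{A}=\{a+a' : a,a'\in\mathcal{A}\}$. $\log$ is the natural logarithm. *)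

(* Defs.v *)
From mathcomp Require Import all_boot all_order all_algebra finmap.
From mathcomp Require Import all_classical all_reals all_analysis.
Import Order.TTheory GRing.Theory Num.Theory.
Import numFieldNormedType.Exports.

Set Implicit Arguments.
Unset Strict Implicit.
Unset Printing Implicit Defensive.

Local Open Scope classical_set_scope.
Local Open Scope ring_scope.

(* [max_pdiv n] is P^+(n), with the convention P^+(1) = 1. *)
Definition smooth (R : realType) (x y : R) : set nat :=
  [set n : nat | (0 < n)%N /\ n%:R <= x /\ (max_pdiv n)%:R <= y].

Definition sumset (A : set nat) : set nat :=
  [set (a + a')%N | a in A & a' in A].

(* [fset_set A] is the empty set when [A] is infinite; [finite_smooth] and
   [finite_sumset_smooth] rule this out for the sets to which it is applied. *)
Definition setcard (A : set nat) : nat := #|` fset_set A|%fset.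

Definition Psi (R : realType) (x y : R) : nat := setcard (smooth x y).

Lemma finite_smooth (R : realType) (x y : R) : finite_set (smooth x y).
Proof.
apply: (@sub_finite_set _ _ `I_(Num.truncn x).+1); last exact: finite_II.
by move=> n [_ [nx _]] /=; rewrite -(ltr_nat R); apply: le_lt_trans nx (truncnS_gt x).
Qed.

Lemma finite_sumset_smooth (R : realType) (x y : R) :
  finite_set (sumset (smooth x y)).
Proof. by apply: finite_image2; apply: finite_smooth. Qed.

(* Main.v *)
(* Since [Psi <= |S + S| <= 3 x], it suffices that [Psi(x, y) = x^(1 + o(1))].
   Fix [b], let [l] be the integer part of [log_2 x] and [N = 2 l^(b+2)], which is
   at most [y] for large [x].  From [2^n <= 'C(2n, n) <= (2n)^pi(2n)] one gets
   [pi(N) >= l^(b+1)].  If [k] is maximal with [N^k <= x], then the products of [k]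
   primes up to [N] are [y]-smooth, at most [x], and each arises from at most
   [k^k <= l^k] tuples, so [Psi >= l^(b k)], while [x < N^(k+1) <= l^((b+3)(k+1))].
   As [k >= b + 2] eventually, [ln x / ln Psi] is at most [1 + O(1/b)]. *)
Require Import Defs.
From mathcomp Require Import all_boot all_order all_algebra finmap.
From mathcomp Require Import all_classical all_reals all_analysis.
From mathcomp Require Import zify ring lra.
Import Order.TTheory GRing.Theory Num.Theory.
Import numFieldNormedType.Exports.

Set Implicit Arguments.
Unset Strict Implicit.
Unset Printing Implicit Defensive.

Local Open Scope nat_scope.

(** * Chebyshev's lower bound for the prime-counting function *)

Definition prime_pi (n : nat) : nat := #|[pred i : 'I_n.+1 | prime i]|.

Lemma size_primes_le_prime_pi (s : seq nat) (n : nat) :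
  uniq s -> {in s, forall p, prime p /\ p <= n} -> size s <= prime_pi n.
Proof.
move=> us sn; rewrite /prime_pi cardE -(size_map val).
apply: uniq_leq_size => // p /sn[pp pn].
by apply/mapP; exists (Ordinal (pn : p < n.+1)); rewrite // mem_enum inE.
Qed.

(** Legendre's formula over a range that may exceed [m]: the extra terms vanish because [p ^ k > m].
    A common range lets the valuations of [n!], [m!] and [(n - m)!] be compared term by term. *)
Lemma logn_fact_widen (p m n : nat) : prime p -> m <= n ->
  logn p m`! = \sum_(1 <= k < n.+1) m %/ p ^ k.
Proof.
move=> pp mn; rewrite logn_fact // [RHS](big_cat_nat (n := m.+1)) //=.
rewrite [X in _ = _ + X]big_nat [X in _ = _ + X]big1 ?addn0 // => k /andP[mk _].
by rewrite divn_small // (leq_trans mk) // ltnW // ltn_expl // prime_gt1.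
Qed.

(** By Legendre's formula each [k] contributes to the valuation of the binomial coefficient only the
    carry in adding [m] and [n - m] modulo [p ^ k]. The carry is at most 1, and it vanishes once
    [p ^ k > n]. *)
Lemma prime_power_bin (p m n : nat) : prime p -> 0 < n -> m <= n ->
  p ^ logn p 'C(n, m) <= n.
Proof.
move=> pp n0 mn; have p1 := prime_gt1 pp.
apply: leq_trans (trunc_logP p1 n0); rewrite leq_exp2l //.
set T := trunc_log p n.
have Tn : T <= n by apply: leq_trans (trunc_logP p1 n0); rewrite ltnW // ltn_expl.
have := congr1 (logn p) (bin_fact mn).
rewrite !lognM ?muln_gt0 ?fact_gt0 ?bin_gt0 //.
rewrite (logn_fact_widen pp mn) (logn_fact_widen pp (leq_subr m n)).
rewrite (logn_fact_widen pp (leqnn n)) -big_split /= => E.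
suff H : \sum_(1 <= k < n.+1) n %/ p ^ k <=
    T + \sum_(1 <= k < n.+1) (m %/ p ^ k + (n - m) %/ p ^ k).
  by rewrite -E leq_add2r in H.
rewrite -[X in X + _](subn0 T) -subSS.
rewrite -[_ - _]muln1 -sum_nat_const_nat (big_cat_nat (n := T.+1)) //=.
rewrite [X in _ <= _ + X](big_cat_nat (n := T.+1)) //= addnA -big_split /=.
apply: leq_add.
  apply: leq_sum => k _; rewrite -{1}(subnKC mn) divnD ?expn_gt0 ?prime_gt0 //.
  by rewrite addnC leq_add2r leq_b1.
rewrite big_nat big1 // => k /andP[Tk _]; apply: divn_small.
by apply: leq_trans (trunc_log_ltn n p1) _; rewrite leq_exp2l.
Qed.

Lemma leq_exp2_central_bin (n : nat) : 2 ^ n <= 'C(n.*2, n).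
Proof.
elim: n => // n IH; rewrite doubleS !binS expnS mul2n -addnn.
apply: leq_add; first by rewrite (leq_trans IH) // leq_addl.
by apply: leq_trans IH _; rewrite leq_bin2l.
Qed.

Lemma leq_exp2_exp_prime_pi (n : nat) : 0 < n -> 2 ^ n <= n.*2 ^ prime_pi n.*2.
Proof.
move=> n0; apply: leq_trans (leq_exp2_central_bin n) _.
have nn : n <= n.*2 by rewrite -addnn leq_addr.
have nn0 : 0 < n.*2 by rewrite double_gt0.
set C := 'C(_, _); have C0 : 0 < C by rewrite bin_gt0.
rewrite (prod_prime_decomp C0) prime_decompE big_map /=.
have pC p : p \in primes C -> p ^ logn p C <= n.*2.
  by rewrite mem_primes => /andP[pp _]; apply: prime_power_bin.
apply: (@leq_trans (\prod_(p <- primes C) n.*2)).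
  by rewrite !big_seq; apply: leq_prod => p /pC.
rewrite big_const_seq count_predT iter_muln_1 leq_pexp2l //.
apply: size_primes_le_prime_pi => [|p pi]; first exact: primes_uniq.
have := pi; rewrite mem_primes => /andP[pp _]; split=> //.
apply: leq_trans (pC _ pi); rewrite -logn_gt0 in pi.
by rewrite -{1}(expn1 p); apply: leq_pexp2l; first exact: prime_gt0.
Qed.

(** * Smooth numbers as products of tuples of primes *)

Lemma leq_card_fibres (S T : finType) (D : {set S}) (f : S -> T) (c : nat) :
  (forall v, #|[set t in D | f t == v]| <= c) -> #|D| <= #|f @: D| * c.
Proof.
move=> fc; rewrite -sum1_card (partition_big f (mem (f @: D))) /=; last first.
  by move=> t tD; apply: imset_f.
rewrite -sum_nat_const; apply: leq_sum => v _; apply: leq_trans (fc v).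
by rewrite -sum1_card; apply: eq_leq; apply: eq_bigl => t; rewrite inE.
Qed.

Lemma mem_primes_prod (I : finType) (t : I -> nat) (p : nat) :
  (forall i, prime (t i)) -> p \in primes (\prod_i t i) -> exists i, p = t i.
Proof.
move=> tp; rewrite mem_primes => /and3P[pp _].
rewrite Euclid_dvd_prod // big_has => /hasP[i _].
by rewrite dvdn_prime2 // => /eqP; exists i.
Qed.

Lemma leq_size_setcard (A : set nat) (s : seq nat) :
  finite_set A -> uniq s -> (forall n, n \in s -> A n) -> size s <= setcard A.
Proof.
move=> fA us sA; rewrite /setcard; apply: uniq_leq_size => // n /sA An.
by rewrite in_fset_set // mem_set.
Qed.

Lemma setcard_leq_size (A : set nat) (s : seq nat) :
  finite_set A -> (forall n, A n -> n \in s) -> setcard A <= size s.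
Proof.
move=> fA sA; rewrite /setcard; apply: uniq_leq_size; first exact: fset_uniq.
by move=> n; rewrite in_fset_set // => /set_mem/sA.
Qed.

Lemma leq_exp_prime_pi_Psi (R : realType) (x y : R) (N k : nat) :
  (1 <= y)%R -> (N%:R <= y)%R -> ((N ^ k)%:R <= x)%R ->
  prime_pi N ^ k <= Psi x y * k ^ k.
Proof.
move=> y1 Ny Nx.
pose P := [pred i : 'I_N.+1 | prime i].
pose D := [set t : {ffun 'I_k -> 'I_N.+1} | t \in ffun_on P].
(* The product never exceeds [N ^ k], so [inord] leaves it unchanged ([valf]); the bounded type
   makes the image of [D] a finite set. *)
pose f (t : {ffun 'I_k -> 'I_N.+1}) : 'I_(N ^ k).+1 := inord (\prod_i t i).
have DP t : t \in D -> forall i, prime (t i).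
  by rewrite inE => /ffun_onP tP i; have := tP i; rewrite inE.
have valf t : f t = \prod_i t i :> nat.
  rewrite inordK // ltnS -[X in N ^ X](card_ord k) -prod_nat_const.
  by apply: leq_prod => i _; rewrite -ltnS.
have <- : #|D| = prime_pi N ^ k.
  by rewrite cardsE card_ffun_on card_ord.
apply: (@leq_trans (#|f @: D| * k ^ k)); last first.
  rewrite leq_mul2r; apply/orP; right.
  rewrite cardE -(size_map val); apply: leq_size_setcard => [||n].
  - exact: finite_smooth.
  - by rewrite map_inj_uniq ?enum_uniq //; apply: val_inj.
  case/mapP => v; rewrite mem_enum => /imsetP[t tD ->] /= -> {v n}.
  have t0 : 0 < f t by rewrite valf; apply: prodn_gt0 => i; apply/prime_gt0/DP.
  split=> //; split; first by apply: le_trans Nx; rewrite ler_nat -ltnS.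
  (* The empty product ([k = 0]) is 1, which has no prime factor; there the convention for
     [max_pdiv 1] and [1 <= y] are used. *)
  have [f1|f1] := leqP (f t) 1.
    by have -> : f t = 1 :> nat by apply/eqP; rewrite eqn_leq f1.
  have [i ->] : exists i, max_pdiv (f t) = t i.
    by apply: mem_primes_prod (DP t tD) _; rewrite -valf; rewrite -pi_max_pdiv in f1.
  by apply: le_trans Ny; rewrite ler_nat -ltnS.
apply: leq_card_fibres => v.
pose Q := [pred i : 'I_N.+1 | nat_of_ord i \in primes v].
(* The entries of a factorisation of [v] into [k] primes lie among the at most
   [k] prime divisors of [v]. *)
have [->|] := set_0Vmem [set t in D | f t == v]; first by rewrite cards0.
case=> t0; rewrite inE => /andP[t0D /eqP ft0].
have Qk : #|Q| <= k.
  rewrite -[X in _ <= X]card_ord -(size_codom t0) cardE.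
  apply: uniq_leq_size; first exact: enum_uniq.
  move=> p; rewrite mem_enum inE -ft0 valf => /(mem_primes_prod (DP _ t0D))[i pi].
  by apply/codomP; exists i; apply: val_inj.
apply: leq_trans (_ : #|ffun_on Q : {pred {ffun 'I_k -> 'I_N.+1}}| <= _); last first.
  rewrite card_ffun_on card_ord.
  by have [->|k0] := posnP k; rewrite ?expn0 ?leq_exp2r.
apply: subset_leq_card; apply/fintype.subsetP => t; rewrite inE => /andP[tD /eqP ftv].
apply/ffun_onP => i; rewrite inE /= -ftv mem_primes DP //= valf.
rewrite (prodn_gt0 (fun i => prime_gt0 (DP t tD i))) /=.
by rewrite (bigD1 i) //= dvdn_mulr.
Qed.

(** * Explicit bounds for the sumset and for [Psi] *)

Lemma leq_exp2rW (m n e : nat) : m <= n -> m ^ e <= n ^ e.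
Proof. by move=> mn; have [->|e0] := posnP e; rewrite ?expn0 ?leq_exp2r. Qed.

(** As 1 is smooth, the sumset contains a translate of the smooth set. All sums lie between 0 and
    twice the integer part of [x], and [2 x + 1 <= 3 x]. *)
Lemma sumset_setcard_bounds (R : realType) (x y : R) : (1 <= y)%R -> (1 <= x)%R ->
  Psi x y <= setcard (sumset (smooth x y)) /\
  ((setcard (sumset (smooth x y)))%:R <= 3 * x)%R.
Proof.
move=> y1 x1; split.
  rewrite -[Psi x y](size_map (addn 1)); apply: leq_size_setcard => [||n].
  - exact: finite_sumset_smooth.
  - by rewrite map_inj_uniq ?fset_uniq //; apply: addnI.
  case/mapP => m; rewrite in_fset_set; last exact: finite_smooth.
  by move=> /set_mem Sm ->; exists 1; [split|exists m].
set X := Num.truncn x.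
have Xx : (X%:R <= x)%R by rewrite truncn_le (le_trans ler01).
have H : setcard (sumset (smooth x y)) <= (X + X).+1.
  rewrite -[X in _ <= X](size_iota 0); apply: setcard_leq_size.
    exact: finite_sumset_smooth.
  move=> _ [m [_ [mx _]]] [n [_ [nx _]]] <-.
  have x0 : (0 <= x)%R by rewrite (le_trans ler01).
  by rewrite mem_iota /= add0n ltnS leq_add // truncn_ge_nat.
rewrite -(ler_nat R) -addn1 !natrD in H.
by lra.
Qed.

(** If [prime_pi N < l ^ (b + 1)], then [N <= 2 ^ l] would force
    [N ^ prime_pi N < 2 ^ (l ^ (b + 2))], against Chebyshev's bound. Dividing [l ^ ((b + 1) k)] by
    the multiplicity [k ^ k <= l ^ k] leaves [l ^ (b k)]. *)
Lemma leq_exp_Psi (R : realType) (x y : R) (b l k : nat) :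
  (l ^ (b + 2)).*2 <= 2 ^ l -> 0 < l -> k <= l ->
  (((l ^ (b + 2)).*2)%:R <= y)%R -> (((l ^ (b + 2)).*2 ^ k)%:R <= x)%R ->
  l ^ (b * k) <= Psi x y.
Proof.
set N := _.*2 => Nl l0 kl Ny Nx.
have lb0 : 0 < l ^ (b + 2) by rewrite expn_gt0 l0.
have N1 : 1 < N by rewrite /N -addnn; lia.
have piN : l ^ (b + 1) <= prime_pi N.
  rewrite leqNgt; apply/negP => piN.
  have := leq_exp2_exp_prime_pi lb0; rewrite -/N => H.
  have : N ^ prime_pi N < N ^ (l ^ (b + 1)) by rewrite ltn_exp2l.
  apply/negP; rewrite -leqNgt; apply: leq_trans H.
  rewrite addn2 -[b.+1]addn1 expnS expnM; exact: leq_exp2rW.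
have y1 : (1 <= y)%R by apply: le_trans Ny; rewrite ler1n ltnW.
rewrite -(leq_pmul2r (m := l ^ k)) ?expn_gt0 ?l0 // -expnD.
apply: (@leq_trans (prime_pi N ^ k)).
  rewrite -mulSnr -[b.+1]addn1 expnM.
  exact: leq_exp2rW.
apply: leq_trans (leq_exp_prime_pi_Psi y1 Ny Nx) _; rewrite leq_mul2l.
by rewrite leq_exp2rW ?orbT.
Qed.

(** With [q = l %/ d], the threshold gives [q >= 2 d + 1], hence
    [q + 1 <= 2 (q - d) <= 2 ^ (q - d)]. Thus [l <= d (q + 1) <= 2 ^ d * 2 ^ (q - d) = 2 ^ q], and
    the [d]-th power is at most [2 ^ l]. *)
Lemma leq_expn_exp2 (d l : nat) : d * (2 * d + 1) <= l -> l ^ d <= 2 ^ l.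
Proof.
have [->|d0] := posnP d; first by rewrite expn0 expn_gt0.
move=> dl; set q := l %/ d.
have qd : 2 * d + 1 <= q by rewrite leq_divRL // mulnC.
have lq : l <= d * q.+1 by rewrite mulnC ltnW // ltn_ceil.
have double r : 0 < r -> 2 * r <= 2 ^ r.
  elim: r => // -[|r] IH _ //; rewrite expnS leq_mul2l /=.
  by apply: leq_trans (IH _) => //; lia.
have dq : d * q.+1 <= 2 ^ q.
  rewrite -(subnKC (_ : d <= q)); last by lia.
  rewrite expnD leq_mul ?(ltnW (ltn_expl d _)) //.
  apply: leq_trans (double _ _); lia.
apply: (@leq_trans ((2 ^ q) ^ d)); first by rewrite leq_exp2r // (leq_trans lq).
by rewrite -expnM leq_exp2l // leq_trunc_div.
Qed.

(** Two losses multiply: [(b + 3) / b] from the exponents of [l] in the bounds for [x] and [Psi],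
    and [(k + 1) / k <= (b + 3) / (b + 2)]. The latter needs [k >= b + 2], which the hypothesis
    [N ^ (b + 2) <= 2 ^ l] provides. *)
Lemma ln_Psi_ge (R : realType) (x y : R) (b : nat) (l := trunc_log 2 (Num.truncn x)) :
  1 < l -> (l ^ (b + 2)).*2 ^ (b + 2) <= 2 ^ l -> (((l ^ (b + 2)).*2)%:R <= y)%R ->
  (b%:R * (b%:R + 2) * ln x <= (b%:R + 3) ^+ 2 * ln (Psi x y)%:R)%R.
Proof.
set X := Num.truncn x in l *; set N := _.*2 => l1 Nl Ny.
have l0 : 0 < l by apply: ltnW.
have X0 : 0 < X by rewrite lt0n; apply: contraTneq l1; rewrite /l => ->.
have x1 : (1 <= x)%R by rewrite -truncn_gt0.
have x0 : (0 < x)%R by apply: lt_le_trans x1.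
have lX : 2 ^ l <= X by apply: trunc_logP.
have lb0 : 0 < l ^ (b + 2) by rewrite expn_gt0 l0.
have N1 : 1 < N by rewrite /N -addnn; lia.
set k := trunc_log N X.
have Xk : N ^ k <= X by apply: trunc_logP.
have kX : X < N ^ k.+1 by apply: trunc_log_ltn.
have bk : b + 2 <= k by apply: trunc_log_max => //; apply: leq_trans lX.
have kl : k <= l.
  by apply: trunc_log_max => //; apply: leq_trans Xk; apply: leq_exp2rW.
have Nlb : N <= l ^ (b + 3).
  by rewrite /N -mul2n (addnS b 2) expnS leq_mul2r l1 orbT.
have Nl' : N <= 2 ^ l.
  by apply: leq_trans Nl; rewrite -{1}(expn1 N) leq_exp2l // addn2.
have Xx : (X%:R <= x)%R by rewrite truncn_le ltW.
have P := @leq_exp_Psi R x y b l k Nl' l0 kl Ny (le_trans (_ : _ <= X%:R)%R Xx).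
rewrite ler_nat in P; have {}P := P Xk.
have lR0 : (0 < l%:R :> R)%R by rewrite ltr0n.
have lnl0 : (0 <= ln l%:R :> R)%R by rewrite ln_ge0 // ler1n.
have lnP : (b%:R * k%:R * ln l%:R <= ln (Psi x y)%:R :> R)%R.
  rewrite -natrM mulr_natl -lnXn // ler_ln ?posrE ?exprn_gt0 ?ltr0n //.
    by rewrite -natrX ler_nat.
  by apply: leq_trans P; rewrite expn_gt0 l0.
have lnx : (ln x <= (b%:R + 3) * (k%:R + 1) * ln l%:R)%R.
  have -> : ((b%:R + 3) * (k%:R + 1) = ((b + 3) * (k + 1))%:R :> R)%R.
    by rewrite natrM !natrD.
  rewrite mulr_natl -lnXn // ler_ln ?posrE ?exprn_gt0 //.
  (* The strict integer inequality [X < N ^ k.+1] gives [x < X + 1 <= N ^ k.+1]. *)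
  apply: (@le_trans _ _ (X.+1)%:R%R); first by rewrite ltW // truncnS_gt.
  rewrite -natrX ler_nat (leq_trans kX) // expnM addn1.
  exact: leq_exp2rW.
have bkR : (b%:R + 2 <= k%:R :> R)%R by rewrite -natrD ler_nat.
have b0 : (0 <= b%:R :> R)%R by [].
apply: (@le_trans _ _ ((b%:R * (b%:R + 2)) * ((b%:R + 3) * (k%:R + 1) * ln l%:R)))%R.
  by rewrite ler_wpM2l // mulr_ge0 // addr_ge0.
apply: (@le_trans _ _ ((b%:R + 3) ^+ 2 * (b%:R * k%:R * ln l%:R)))%R; last first.
  by rewrite ler_wpM2l // sqr_ge0.
rewrite -subr_ge0.
have -> : ((b%:R + 3) ^+ 2 * (b%:R * k%:R * ln l%:R) - b%:R * (b%:R + 2) * ((b%:R + 3) * (k%:R + 1) * ln l%:R)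
  = (b%:R + 3) * b%:R * ln l%:R * (k%:R - (b%:R + 2)) :> R)%R by ring.
by rewrite mulr_ge0 ?subr_ge0 // !mulr_ge0 // addr_ge0.
Qed.

(** * Asymptotics for large [x] *)

Lemma near_ln_ge (R : realType) (A : R) : (\forall x \near +oo, A <= ln x)%R.
Proof.
near=> x.
have Ax : (expR A <= x)%R by near: x; apply: nbhs_pinfty_ge; rewrite num_real.
by rewrite -[A]expRK ler_ln ?posrE ?expR_gt0 // (lt_le_trans _ Ax) // expR_gt0.
Unshelve. all: by end_near. Qed.

(** From [2 ^ l <= x] one gets [l <= ln x / ln 2], and the second factor [ln x] absorbs [1 / ln 2].
    The square is harmless, since [y] eventually exceeds every fixed power of [ln x]. *)
Lemma trunc_log2_truncn_le (R : realType) (x : R) :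
  (1 <= x -> 1 <= ln 2 * ln x ->
   (trunc_log 2 (Num.truncn x))%:R <= ln x ^+ 2)%R.
Proof.
move=> x1; set l := trunc_log _ _ => lnx.
have x0 : (0 < x)%R by apply: lt_le_trans x1.
have lx : (l%:R * ln 2 <= ln x :> R)%R.
  rewrite mulr_natl -lnXn // ler_ln ?posrE ?exprn_gt0 // -natrX.
  apply: (@le_trans _ _ (Num.truncn x)%:R%R); last by rewrite truncn_le ltW.
  by rewrite ler_nat trunc_logP // truncn_gt0.
have ln2 : (0 < ln 2 :> R)%R by rewrite ln_gt0 // ltr1n.
have lnx0 : (0 <= ln x)%R by rewrite ln_ge0.
apply: (@le_trans _ _ (l%:R * (ln 2 * ln x)))%R; first by rewrite ler_peMr.
by rewrite mulrA expr2 ler_wpM2r.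
Qed.

Lemma near_trunc_log2_ge (R : realType) (L : nat) :
  \forall x \near (+oo%R : set_system R), L <= trunc_log 2 (Num.truncn x).
Proof.
near=> x; apply: trunc_log_max => //.
have x0 : (0 <= x)%R by near: x; apply: nbhs_pinfty_ge; rewrite num_real.
rewrite truncn_ge_nat //; near: x; apply: nbhs_pinfty_ge; rewrite num_real //.
Unshelve. all: by end_near. Qed.

Lemma near_ln_Psi_ge (R : realType) (y : R -> R) (b : nat) :
  (ln (y x) / ln (ln x) @[x --> +oo] --> +oo)%R%classic ->
  (\forall x \near +oo, 2 <= y x)%R%classic ->
  (\forall x \near +oo,
    b%:R * (b%:R + 2) * ln x <= (b%:R + 3) ^+ 2 * ln (Psi x (y x))%:R)%R%classic.
Proof.
move=> /cvgryPge hlog hy; near=> x.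
have x1 : (1 <= x)%R by near: x; apply: nbhs_pinfty_ge; rewrite num_real.
set l := trunc_log 2 (Num.truncn x).
(* This is the threshold of [leq_expn_exp2] for [d = (b + 3) (b + 2)], chosen because
   [N <= l ^ (b + 3)] gives [N ^ (b + 2) <= l ^ d]. *)
have [l1 lL] : 1 < l /\ (b + 3) * (b + 2) * (2 * ((b + 3) * (b + 2)) + 1) <= l.
  by split; rewrite /l; near: x; apply: near_trunc_log2_ge.
have ln2 : (0 < ln 2 :> R)%R by rewrite ln_gt0 // ltr1n.
have lnx1 : (1 < ln x)%R.
  by apply: (@lt_le_trans _ _ 2%R); [rewrite ltr1n|near: x; apply: near_ln_ge].
have lnx2 : (1 <= ln 2 * ln x)%R.
  by rewrite mulrC -ler_pdivrMr //; near: x; apply: near_ln_ge.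
have lnx0 : (0 < ln x)%R by apply: lt_trans lnx1.
have llnx : (0 < ln (ln x))%R by rewrite ln_gt0.
have Nlb : (l ^ (b + 2)).*2 <= l ^ (b + 3).
  by rewrite -mul2n (addnS b 2) expnS leq_mul2r l1 orbT.
apply: ln_Psi_ge => //; rewrite -/l.
  by apply: leq_trans (leq_exp2rW _ Nlb) _; rewrite -expnM; apply: leq_expn_exp2.
apply: (@le_trans _ _ (l ^ (b + 3))%:R)%R; first by rewrite ler_nat.
apply: (@le_trans _ _ ((ln x ^+ 2) ^+ (b + 3)))%R.
  by rewrite natrX lerXn2r ?nnegrE ?exprn_ge0 ?(ltW lnx0) ?trunc_log2_truncn_le.
have y0 : (0 < y x)%R by apply: (@lt_le_trans _ _ 2%R) => //; near: x.
(* What remains is that [ln (y x) / ln (ln x)] eventually exceeds the constant [2 (b + 3)]. *)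
rewrite -exprM -ler_ln ?posrE ?exprn_gt0 // lnXn // -mulr_natl.
by rewrite -ler_pdivlMr //; near: x; apply: hlog.
Unshelve. all: by end_near. Qed.

Local Close Scope nat_scope.
Local Open Scope classical_set_scope.
Local Open Scope ring_scope.

Theorem theorem5 (R : realType) (y : R -> R)
    (hy : \forall x \near +oo, 2 <= y x <= x)
    (hlog : ln (y x) / ln (ln x) @[x --> +oo] --> +oo) :
  ln (setcard (sumset (smooth x (y x))))%:R / ln (Psi x (y x))%:R
    @[x --> +oo] --> (1 : R).
Proof.
have hy2 : \forall x \near +oo, 2 <= y x by apply: filterS hy => x /andP[].
apply/cvgrPdist_le => e e0.
(* The final ratio is at most [1 + 29 / b]. For [b >= 1], [(b + 1) (b + 3)^2 = b^3 + 7 b^2 + 15 b +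
   9 <= b^3 + 31 b^2 <= b (b + 2) (b + 29)]. *)
pose b := (Num.truncn (29 / e)).+1%N.
have b0 : (0 : R) < b%:R by rewrite ltr0n.
have be : 29 <= e * b%:R.
  by rewrite mulrC -ler_pdivrMr // ltW // truncnS_gt.
near=> x.
have x1 : 1 <= x by near: x; apply: nbhs_pinfty_ge; rewrite num_real.
have x0 : 0 < x by apply: lt_le_trans x1.
have y1 : 1 <= y x.
  by apply: (@le_trans _ _ 2); [rewrite ler1n|near: x].
have lnx1 : 1 <= ln x by near: x; apply: near_ln_ge.
(* This absorbs the factor 3 of the sumset bound: [b (ln 3 + ln x) <= (b + 1) ln x]. *)
have lnx3 : b%:R * ln 3 <= ln x by near: x; apply: near_ln_ge.
have HP : b%:R * (b%:R + 2) * ln x <= (b%:R + 3) ^+ 2 * ln (Psi x (y x))%:R.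
  by near: x; apply: near_ln_Psi_ge.
have [PS Sx] := sumset_setcard_bounds y1 x1.
set P := ln (Psi x (y x))%:R in HP *.
set S := ln (setcard _)%:R.
have P0 : 0 < P.
  rewrite -(pmulr_rgt0 _ (_ : 0 < (b%:R + 3) ^+ 2)) ?exprn_gt0 ?addr_gt0 //.
  by apply: lt_le_trans HP; rewrite !mulr_gt0 ?addr_gt0 // (lt_le_trans _ lnx1).
(* Since [ln 0 = 0] by convention, [P > 0] excludes [Psi = 0]. *)
have Psi0 : (0 < Psi x (y x))%N.
  by rewrite lt0n; apply: contraTneq P0 => PE; rewrite /P PE ln0 // ltxx.
have PS' : P <= S.
  by rewrite ler_ln ?posrE ?ltr0n ?ler_nat // (leq_trans Psi0).
have S3 : S <= ln 3 + ln x.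
  by rewrite -lnM ?posrE // ler_ln ?posrE ?mulr_gt0 // ltr0n (leq_trans Psi0).
have SP : b%:R * S <= (b%:R + 29) * P.
  have B1 : 1 <= b%:R :> R by rewrite ler1n.
  have H1 : b%:R * S <= (b%:R + 1) * ln x by nra.
  have H2 : b%:R * (b%:R + 2) * (b%:R * S) <= (b%:R + 1) * (b%:R + 3) ^+ 2 * P.
    have := ler_wpM2l (_ : 0 <= b%:R * (b%:R + 2)) H1.
    have := ler_wpM2l (_ : 0 <= b%:R + 1) HP.
    move=> /(_ ltac:(lra)) h1 /(_ ltac:(nra)) h2; lra.
  have H3 : (b%:R + 1) * (b%:R + 3) ^+ 2 * P <= b%:R * (b%:R + 2) * ((b%:R + 29) * P).
    by rewrite !mulrA ler_wpM2r ?ltW //; nra.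
  have b2 : 0 < b%:R * (b%:R + 2) :> R by rewrite mulr_gt0 ?addr_gt0.
  by rewrite -(ler_pM2l b2) (le_trans H2).
have SP' : S <= (1 + e) * P by rewrite -(ler_pM2l b0) (le_trans SP) //; nra.
have -> : 1 - S / P = - ((S - P) / P) by field; rewrite gt_eqF.
rewrite normrN ger0_norm ?divr_ge0 ?subr_ge0 ?(ltW P0) // ler_pdivrMr //; lra.
Unshelve. all: by end_near. Qed.
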